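(* Let $A$ and $B$ be real symmetric positive definite $N\times N$ matrices, and assume there exist real numbers $\alpha,\beta>0$ such that $$\alpha\langle Bu,u\rangle\le\langle Au,u\rangle\le\beta\langle Bu,u\rangle\qquad\forall u\in\mathbb{R}^N .$$ Let $\epsilon>0$, $\tau>0$, and assume that $f:\mathbb{R}\to\mathbb{R}$ is of class $C^1$ with $|f'|_\infty\le L$. Consider, for $\Delta t>0$, the scheme $$\frac{u^{(k+1)}-u^{(k)}}{\Delta t}+\tau B\,(u^{(k+1)}-u^{(k)})+\frac{1}{\epsilon^2}f(u^{(k)})=-Au^{(k)} .$$ Let $\lambda_{\min}$ be the smallest eigenvalue of $A$ and $\rho(A)$ its spectral radius. Then the following stability conditions hold: (1) If $\tau\ge\frac{\beta}{2}$, then: (a) if $\left(\frac{\tau}{\beta}-\frac12\right)\lambda_{\min}-\frac{L}{2\epsilon^2}\ge0$, the scheme is unconditionally stable (stable for every $\Delta t>0$); (b) if $\left(\frac{\tau}{\beta}-\frac12\right)\lambda_{\min}-\frac{L}{2\epsilon^2}<0$, the scheme is stable for $$0<\Delta t<\frac{1}{\frac{L}{2\epsilon^2}-\left(\frac{\tau}{\beta}-\frac12\right)\lambda_{\min}} .$$ (2) If $\tau<\frac{\beta}{2}$, the scheme is stable for $$0<\Delta t<\frac{1}{\frac{L}{2\epsilon^2}-\left(\frac{\tau}{\beta}-\frac12\right)\rho(A)} .$$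
   Context: $\langle\cdot,\cdot\rangle$ is the Euclidean scalar product on $\mathbb{R}^N$, and $|f'|_\infty=\sup_{s\in\mathbb{R}}|f'(s)|$. For $u\in\mathbb{R}^N$, $f(u)$ denotes the vector with components $f(u_i)$. Let $F$ be the primitive of $f$ with $F(0)=0$, also applied componentwise, and define the energy $E(u)=\frac12\langle Au,u\rangle+\frac{1}{\epsilon^2}\langle F(u),\mathbf{1}\rangle$, where $\mathbf{1}=(1,\dots,1)^T$. ''Stable'' means that the scheme is energy decreasing, i.e. $E(u^{(k+1)})<E(u^{(k)})$.
   Formalization: Strict decrease E(u^(k+1)) < E(u^(k)) is required only at steps with u^(k+1) ≠ u^(k); at an equilibrium (e.g. f = 0, u^(k) = 0) the iterates coincide and the energies are equal, so the literal claim fails there. *)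

(* Defs.v *)
From HB Require Import structures.
From mathcomp Require Import all_boot all_order all_algebra.
From mathcomp Require Import complex.
From mathcomp Require Import all_classical all_reals all_analysis.
Import Order.TTheory GRing.Theory Num.Theory numFieldNormedType.Exports.

Set Implicit Arguments.
Unset Strict Implicit.
Unset Printing Implicit Defensive.

Local Open Scope classical_set_scope.
Local Open Scope ring_scope.

Definition dotp (R : realType) (N : nat) (u v : 'cV[R]_N) : R :=
  \sum_(i < N) u i 0 * v i 0.

Definition sym_posdef (R : realType) (N : nat) (A : 'M[R]_N) : Prop :=
  A^T = A /\ forall u : 'cV[R]_N, u != 0 -> 0 < dotp (A *m u) u.

Definition is_smallest_eigenvalue (R : realType) (N : nat) (A : 'M[R]_N)
    (l : R) : Prop :=
  eigenvalue A l /\ forall m : R, eigenvalue A m -> l <= m.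

(* The largest modulus of a complex eigenvalue of the real matrix A. *)
Definition is_spectral_radius (R : realType) (N : nat) (A : 'M[R]_N)
    (rho : R) : Prop :=
  let AC : 'M[R[i]]_N := map_mx (real_complex R) A in
  (exists2 z : R[i], eigenvalue AC z & `|z| = real_complex R rho) /\
  (forall z : R[i], eigenvalue AC z -> `|z| <= real_complex R rho).

Definition class_C1 (R : realType) (f : R -> R) : Prop :=
  (forall x : R, derivable f x 1) /\ continuous (derive1 f).

(* Taken in the extended reals: the real-valued [sup] of an unbounded set
   is a junk value. *)
Definition sup_norm (R : realType) (g : R -> R) : \bar R :=
  ereal_sup [set (`|g s|)%:E | s in [set: R]].

Definition is_primitive0 (R : realType) (f F : R -> R) : Prop :=
  (forall x : R, is_derive x 1 F (f x)) /\ F 0 = 0.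

Definition energy (R : realType) (N : nat) (A : 'M[R]_N) (eps : R)
    (F : R -> R) (u : 'cV[R]_N) : R :=
  2^-1 * dotp (A *m u) u
  + (eps ^+ 2)^-1 * dotp (map_mx F u) (const_mx 1).

Definition scheme (R : realType) (N : nat) (A B : 'M[R]_N) (eps tau : R)
    (f : R -> R) (dt : R) (u : nat -> 'cV[R]_N) : Prop :=
  forall k : nat,
    dt^-1 *: (u k.+1 - u k) + tau *: (B *m (u k.+1 - u k))
    + (eps ^+ 2)^-1 *: map_mx f (u k) = - (A *m u k).

(* At an equilibrium (A u + f(u)/eps^2 = 0) the scheme gives u^(k+1) = u^k, so
   the energy cannot strictly decrease there: the strict decrease is required
   at every step that moves the iterate. *)
Definition stable (R : realType) (N : nat) (A B : 'M[R]_N) (eps tau : R)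
    (f F : R -> R) (dt : R) : Prop :=
  forall u : nat -> 'cV[R]_N, scheme A B eps tau f dt u ->
  forall k : nat, u k.+1 <> u k ->
    energy A eps F (u k.+1) < energy A eps F (u k).

(* Main.v *)
(** Pair the scheme with the increment d = u^(k+1) - u^k.  Together with the
    Taylor bound F(y) - F(x) <= f(x)(y-x) + (L/2)(y-x)^2 and the bound
    <Bd,d> >= <Ad,d>/beta this gives
      E(u^(k+1)) - E(u^k)
        <= (L/(2 eps^2) - 1/dt) |d|^2 - (tau/beta - 1/2) <Ad,d>,
    and <Ad,d> is bounded below by lmin |d|^2 or above by rho |d|^2 according to
    the sign of tau/beta - 1/2. *)

Require Import Defs.
From HB Require Import structures.
From mathcomp Require Import all_boot all_order all_algebra.
From mathcomp Require Import complex.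
From mathcomp Require Import all_classical all_reals all_analysis.
From mathcomp Require Import spectral sesquilinear ring lra.
Import Order.TTheory GRing.Theory Num.Theory numFieldNormedType.Exports.

Set Implicit Arguments.
Unset Strict Implicit.
Unset Printing Implicit Defensive.

Local Open Scope classical_set_scope.
Local Open Scope ring_scope.

Section Dotp.
Variables (R : realType) (N : nat).
Implicit Types (A : 'M[R]_N) (u v w : 'cV[R]_N).

Lemma dotpE u v : dotp u v = (v^T *m u) 0 0.
Proof. by rewrite mxE; apply: eq_bigr => i _; rewrite mxE mulrC. Qed.

Lemma dotpDl u v w : dotp (u + v) w = dotp u w + dotp v w.
Proof. by rewrite !dotpE mulmxDr mxE. Qed.

Lemma dotpDr u v w : dotp w (u + v) = dotp w u + dotp w v.
Proof. by rewrite !dotpE linearD mulmxDl mxE. Qed.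

Lemma dotpZl a u w : dotp (a *: u) w = a * dotp u w.
Proof. by rewrite !dotpE -scalemxAr mxE. Qed.

Lemma dotpNl u w : dotp (- u) w = - dotp u w.
Proof. by rewrite !dotpE mulmxN mxE. Qed.

Lemma dotp_symC A u v : A^T = A -> dotp (A *m u) v = dotp (A *m v) u.
Proof.
move=> sA; rewrite !dotpE -[in LHS](trmxK (v^T *m (A *m u))) mxE.
by rewrite !trmx_mul trmxK sA mulmxA.
Qed.

Lemma dotp_gt0 u : u != 0 -> 0 < dotp u u.
Proof.
move=> u0; rewrite lt_def sumr_ge0 ?andbT => [|i _]; last exact: sqr_ge0.
apply: contra u0 => /eqP uu0; apply/eqP/colP => i; rewrite mxE.
have := psumr_eq0P (fun i _ => sqr_ge0 (u i 0)) uu0.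
by move=> /(_ i isT)/eqP; rewrite sqrf_eq0 => /eqP.
Qed.

(* [w i] is the squared modulus of the [i]-th coordinate of [u] in a unitary
   eigenbasis of the complexified matrix. *)
Lemma symmetric_spectral A : A^T = A ->
  exists2 lam : 'I_N -> R, forall i, eigenvalue A (lam i) &
  forall u, exists2 w : 'I_N -> R, forall i, 0 <= w i &
    dotp u u = \sum_i w i /\ dotp (A *m u) u = \sum_i lam i * w i.
Proof.
move=> sA; pose toC := real_complex R.
(* The spectral theorem is applied to the complexification [AC], which is Hermitian. Its eigenvalues
   are real, so their real parts lose nothing ([dE]). *)
pose AC : 'M[R[i]]_N := map_mx toC A.
have hermA : AC \is hermsymmx.
  apply: realsym_hermsym.
    by apply/is_hermitianmxP; rewrite scale1r map_mx_id// map_trmx sA.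
  by apply/mxOverP => i j; rewrite mxE complex_real.
have /orthomx_spectralP AE := hermitian_normalmx hermA.
have /mxOverP dreal := hermitian_spectral_diag_real hermA.
set P := spectralmx AC in AE; set d := spectral_diag AC in AE dreal.
have Pu : P \is unitarymx by exact: spectral_unitarymx.
have Punit := unitarymx_unit Pu.
have dE i : toC (complex.Re (d 0 i)) = d 0 i by rewrite /toC RRe_real.
exists (fun i => complex.Re (d 0 i)) => [i|u].
  (* Eigenvectors are row vectors here: row [i] of [P] is one for [d 0 i], and it is nonzero because
     [P] is invertible. *)
  rewrite -(eigenvalue_map (real_complex R)) [X in eigenvalue _ X]dE.
  apply/eigenvalueP; exists (row i P).
    rewrite -row_mul /= -/AC AE !mulmxA mulmxV// mul1mx.
    by rewrite row_mul row_diag_mx -scalemxAl -rowE.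
  apply/eqP => Pi0; have /row_freeP[Q PQ] : row_free P by rewrite row_free_unit.
  have /(congr1 (fun M : 'rV_N => M 0 i)) : row i (P *m Q) = 0.
    by rewrite row_mul Pi0 mul0mx.
  by rewrite PQ !mxE eqxx => /eqP; rewrite oner_eq0.
pose x := P *m map_mx toC u.
(* Since [u] is real, conjugating [x] only affects [P], and unitarity turns the conjugate transpose
   of [P] into [invmx P]. *)
have xt : (x ^t Num.conj)%sesqui = (map_mx toC u)^T *m invmx P.
  rewrite invmx_unitary// trmx_mul map_mxM; congr (_ *m _).
  apply/matrixP => i j; rewrite !mxE; apply: conj_Creal.
  by rewrite complex_real.
have toC_dotp (B : 'M[R]_N) :
    toC (dotp (B *m u) u) =
      ((map_mx toC u)^T *m map_mx toC B *m map_mx toC u) 0 0.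
  by rewrite dotpE -mulmxA -map_mxM map_trmx -map_mxM [RHS]mxE.
have wE i : toC (complex.Re (`|x i 0| ^+ 2)) = `|x i 0| ^+ 2.
  by rewrite /toC RRe_real// ger0_real// exprn_ge0.
exists (fun i => complex.Re (`|x i 0| ^+ 2)) => [i|].
  by rewrite -ler0c [_%:C%C]wE exprn_ge0.
(* The diagonal is left free so that a constant [c] yields [dotp u u] and [c := d] yields the form
   of [A]. *)
have quad (c : 'rV[R[i]]_N) : ((map_mx toC u)^T *m (invmx P *m diag_mx c *m P)
    *m map_mx toC u) 0 0 = \sum_i c 0 i * `|x i 0| ^+ 2.
  rewrite !mulmxA -xt -!mulmxA -/x mxE; apply: eq_bigr => i _.
  by rewrite mul_diag_mx !mxE mulrCA sqr_normc [X in _ * X = _]mulrC.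
split; apply: (@complexI R); rewrite [RHS]rmorph_sum.
  have := toC_dotp 1%:M; rewrite mul1mx map_mx1 => dotE; rewrite [LHS]dotE.
  rewrite -(mulVmx Punit) -[X in X *m P]mulmx1 -diag_const_mx quad.
  by apply: eq_bigr => i _; rewrite mxE mul1r [RHS]wE.
rewrite [LHS]toC_dotp -/AC AE quad; apply: eq_bigr => i _.
by rewrite rmorphM/= [X in _ = X * _]dE [X in _ = _ * X]wE.
Qed.

End Dotp.

Lemma mean_value (R : realType) (f df : R -> R) :
  (forall x, is_derive (x : R) (1 : R) f (df x)) ->
  forall a b, a <= b ->
  exists2 c, a <= c <= b & f b - f a = df c * (b - a).
Proof.
move=> fdf a b ab.
have fc : {within `[a, b], continuous f}.
  apply: continuous_subspaceT => x; apply: differentiable_continuous.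
  by apply/derivable1_diffP; have [] := fdf x.
have [c cab ->] := MVT_segment ab (fun x _ => fdf x) fc.
by exists c.
Qed.

(** Since [f] is [L]-Lipschitz, [F] minus the parabola [f x * t + L / 2 * (t - x) ^+ 2] has
    derivative [f t - f x - L * (t - x)], which is nonnegative left of [x] and nonpositive right of
    it. The difference is therefore maximal at [x]. No second derivative of [F] is bounded
    directly. *)
Lemma lipschitz_primitive_le (R : realType) (f F : R -> R) (L : R) :
  (forall x, derivable f (x : R) 1) -> (forall x, `|derive1 f x| <= L) ->
  (forall x, is_derive (x : R) (1 : R) F (f x)) ->
  forall x y, F y - F x <= f x * (y - x) + L / 2 * (y - x) ^+ 2.
Proof.
move=> df fL dF x y.
have flip a b : a <= b -> `|f b - f a| <= L * (b - a).
  move=> ab; have [|c _ ->] := @mean_value _ f (derive1 f) _ a b ab.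
    by move=> z; rewrite derive1E; exact/derivableP.
  by rewrite normrM [`|b - a|]ger0_norm ?subr_ge0// ler_wpM2r ?subr_ge0.
pose g := F \- (fun t => f x * t + L / 2 * (t - x) ^+ 2).
have dg (t : R) : is_derive t (1 : R) g (f t - (f x + L * (t - x))).
  have := dF t.
  rewrite /g => ?.
  apply: is_derive_eq; rewrite /GRing.scale /=; lra.
suff gyx : g y <= g x by move: gyx; rewrite /g /= subrr; lra.
rewrite -subr_le0; have [xy|/ltW yx] := leP x y.
  have [c /andP[xc _] ->] := mean_value dg xy.
  have := flip _ _ xc; rewrite ler_norml => /andP[_ fc].
  by rewrite mulr_le0_ge0 ?subr_ge0//; lra.
have [c /andP[_ cx] gc] := mean_value dg yx.
have := flip _ _ cx; rewrite ler_norml => /andP[_ fc].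
rewrite -opprB gc oppr_le0 mulr_ge0 ?subr_ge0//; lra.
Qed.

Lemma rayleigh_ge (R : realType) (N : nat) (A : 'M[R]_N) (lmin : R) :
  A^T = A -> (forall m, eigenvalue A m -> lmin <= m) ->
  forall u, lmin * dotp u u <= dotp (A *m u) u.
Proof.
move=> sA le_eig u; have [lam eig_lam /(_ u)] := symmetric_spectral sA.
move=> [w w0 [-> ->]]; rewrite mulr_sumr; apply: ler_sum => i _.
by rewrite ler_wpM2r// le_eig.
Qed.

(** Each real eigenvalue of [A] is also one of its complexification, hence at most its modulus,
    which [rho] bounds. *)
Lemma rayleigh_le (R : realType) (N : nat) (A : 'M[R]_N) (rho : R) :
  A^T = A -> is_spectral_radius A rho ->
  forall u, dotp (A *m u) u <= rho * dotp u u.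
Proof.
move=> sA [_ eig_le] u; have [lam eig_lam /(_ u)] := symmetric_spectral sA.
move=> [w w0 [-> ->]]; rewrite mulr_sumr; apply: ler_sum => i _.
rewrite ler_wpM2r// -lecR (le_trans _ (eig_le (lam i)%:C%C _))//.
  by apply: real_ler_norm; rewrite complex_real.
by rewrite [_ (map_mx _ _) _](eigenvalue_map (real_complex R)).
Qed.

Lemma sup_norm_le (R : realType) (g : R -> R) (L : R) :
  (sup_norm g <= L%:E)%E -> forall x, `|g x| <= L.
Proof.
move=> gL x; rewrite -lee_fin; apply: le_trans gL.
by apply: ereal_sup_ubound; exists x.
Qed.

Lemma energy_step_le (R : realType) (N : nat) (A B : 'M[R]_N)
    (beta eps tau L dt : R) (f F : R -> R) (u v : 'cV[R]_N) :
  A^T = A -> 0 < beta -> 0 < eps -> 0 < tau ->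
  dotp (A *m (v - u)) (v - u) <= beta * dotp (B *m (v - u)) (v - u) ->
  (forall x y, F y - F x <= f x * (y - x) + L / 2 * (y - x) ^+ 2) ->
  dt^-1 *: (v - u) + tau *: (B *m (v - u)) + (eps ^+ 2)^-1 *: map_mx f u
    = - (A *m u) ->
  energy A eps F v - energy A eps F u <=
    (L / (2 * eps ^+ 2) - dt^-1) * dotp (v - u) (v - u)
    - (tau / beta - 1 / 2) * dotp (A *m (v - u)) (v - u).
Proof.
move=> sA beta0 eps0 tau0; have -> : v = u + (v - u) by rewrite addrC subrK.
move: (v - u) => d; rewrite {v} [in u + d - u]addrC addKr => AB dF step.
have := congr1 (fun w => dotp w d) step.
rewrite !dotpDl !dotpZl dotpNl => stepd.
have ABd : tau / beta * dotp (A *m d) d <= tau * dotp (B *m d) d.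
  by rewrite -mulrA ler_pM2l// mulrC ler_pdivrMr// mulrC.
(* Symmetry of [A] merges the two cross terms; half of this leaves exactly the term
   [dotp (A *m u) d] that [stepd] expresses through the scheme. *)
have quadE : dotp (A *m (u + d)) (u + d)
    = dotp (A *m u) u + 2 * dotp (A *m u) d + dotp (A *m d) d.
  by rewrite mulmxDr dotpDl !dotpDr (dotp_symC d u sA); ring.
have taylor :
    dotp (map_mx F (u + d)) (const_mx 1) - dotp (map_mx F u) (const_mx 1)
    <= dotp (map_mx f u) d + L / 2 * dotp d d.
  rewrite /dotp -sumrB mulr_sumr -big_split /=; apply: ler_sum => i _.
  have := dF (u i 0) (u i 0 + d i 0); rewrite !mxE !mulr1.
  by rewrite [u i 0 + d i 0 - _]addrC addKr expr2.
have e0 : 0 < (eps ^+ 2)^-1 by rewrite invr_gt0 exprn_gt0.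
move: taylor; rewrite -(ler_pM2l e0) => taylor.
(* Eliminating [dotp (A *m u) d] by [stepd] cancels the [f] terms against [taylor], and [ABd]
   replaces the form of [B] by that of [A]. *)
rewrite /energy quadE invfM; nra.
Qed.

Theorem theorem2p6 (R : realType) (N : nat) (A B : 'M[R]_N)
    (alpha beta eps tau L lmin rho : R) (f F : R -> R)
    (hA : sym_posdef A) (hB : sym_posdef B)
    (halpha : 0 < alpha) (hbeta : 0 < beta)
    (hAB : forall u : 'cV[R]_N,
       alpha * dotp (B *m u) u <= dotp (A *m u) u <= beta * dotp (B *m u) u)
    (heps : 0 < eps) (htau : 0 < tau)
    (hf : class_C1 f) (hL : (sup_norm (derive1 f) <= L%:E)%E)
    (hF : is_primitive0 f F)
    (hlmin : is_smallest_eigenvalue A lmin)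
    (hrho : is_spectral_radius A rho) :
  (beta / 2 <= tau ->
     (0 <= (tau / beta - 1 / 2) * lmin - L / (2 * eps ^+ 2) ->
        forall dt : R, 0 < dt -> stable A B eps tau f F dt) /\
     ((tau / beta - 1 / 2) * lmin - L / (2 * eps ^+ 2) < 0 ->
        forall dt : R, 0 < dt ->
          dt < 1 / (L / (2 * eps ^+ 2) - (tau / beta - 1 / 2) * lmin) ->
          stable A B eps tau f F dt)) /\
  (tau < beta / 2 ->
     forall dt : R, 0 < dt ->
       dt < 1 / (L / (2 * eps ^+ 2) - (tau / beta - 1 / 2) * rho) ->
       stable A B eps tau f F dt).
Proof.
have [sA _] := hA.
have dF := lipschitz_primitive_le (proj1 hf) (sup_norm_le hL) (proj1 hF).
(* Keeping the factor [tau / beta - 1 / 2] in the hypothesis lets one statement serve both signs: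
   [l] is [lmin] when the factor is nonnegative and [rho] when it is negative. *)
have decrease dt l : 0 < dt ->
    (forall u, (tau / beta - 1 / 2) * (l * dotp u u)
       <= (tau / beta - 1 / 2) * dotp (A *m u) u) ->
    L / (2 * eps ^+ 2) - (tau / beta - 1 / 2) * l < dt^-1 ->
    stable A B eps tau f F dt.
  move=> dt0 lA dtl u us k /eqP; rewrite -subr_eq0 => /dotp_gt0 uu0.
  have /andP[_ AB] := hAB (u k.+1 - u k).
  rewrite -subr_lt0.
  apply: le_lt_trans (energy_step_le sA hbeta heps htau AB dF (us k)) _.
  have := lA (u k.+1 - u k); set c := tau / beta - 1 / 2 in dtl *.
  move: (dotp (A *m _) _) (dotp _ _) uu0 => a n n0 cln.
  (* Strictness comes from here: the gap in the time-step condition times the positive squared norm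
     of the increment. *)
  have : 0 < (dt^-1 - (L / (2 * eps ^+ 2) - c * l)) * n.
    by rewrite mulr_gt0// subr_gt0.
  lra.
(* Positivity of the denominator [c] is deduced: [0 < dt < c^-1] excludes [c <= 0], including
   [c = 0], whose inverse is [0]. *)
have invdt (dt c : R) : 0 < dt -> dt < 1 / c -> c < dt^-1.
  move=> dt0; rewrite div1r => dtc.
  have c0 : 0 < c by rewrite -invr_gt0 (lt_trans dt0).
  by rewrite -[X in X < _]invrK ltf_pV2 ?posrE ?invr_gt0.
split=> [tauge|taul].
  have c0 : 0 <= tau / beta - 1 / 2.
    by rewrite subr_ge0 ler_pdivlMr// mulrC mulrA mulr1.
  have lA u : (tau / beta - 1 / 2) * (lmin * dotp u u)
      <= (tau / beta - 1 / 2) * dotp (A *m u) u.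
    by apply: ler_wpM2l => //; apply: rayleigh_ge => //; case: hlmin.
  split=> [cl dt dt0|_ dt dt0 dtl]; apply: (decrease dt lmin) => //.
    (* In case (a) the threshold is at most [0], so every positive [dt] lies in range. *)
    apply: le_lt_trans (_ : 0 < _); first by rewrite -subr_ge0 sub0r opprB.
    by rewrite invr_gt0.
  exact: invdt.
move=> dt dt0 dtl; apply: (decrease dt rho) => // [u|]; last exact: invdt.
(* The negative factor reverses the upper Rayleigh bound into the required lower bound. *)
apply: ler_wnM2l; last exact: rayleigh_le.
by rewrite subr_le0 ler_pdivrMr// mulrC mulrA mulr1 ltW.
Qed.
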